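(* Let $G$ be a group generated by a subset $S$, let $\mathcal{D}(S^G)$ be the Dehn quandle of $G$ with respect to $S$, and let $\Phi:\operatorname{Env}(\mathcal{D}(S^G))\to G$ be the surjective group homomorphism defined by $\Phi(e_x)=x$ for $x\in\mathcal{D}(S^G)$. Then $$1\to\ker(\Phi)\to\operatorname{Env}(\mathcal{D}(S^G))\xrightarrow{\ \Phi\ } G\to 1$$ is a central extension of groups. Further, if the abelianization $G_{ab}$ of $G$ has torsion, then this extension does not split.
   Context: A quandle is a non-empty set $Q$ with a binary operation $*$ such that: (i) $x*x=x$ for all $x$; (ii) for all $x,y\in Q$ there is a unique $z\in Q$ with $x=z*y$; (iii) $(x*y)*z=(x*z)*(y*z)$ for all $x,y,z$. For a group $G$ and a non-empty subset $A\subseteq G$, let $A^G$ be the set of all conjugates in $G$ of elements of $A$. The Dehn quandle $\mathcal{D}(A^G)$ is the set $A^G$ with the operation $x*y=yxy^{-1}$. The enveloping group $\operatorname{Env}(Q)$ of a quandle $Q$ is the group with generators $\{e_x\mid x\in Q\}$ and defining relations $e_{x*y}=e_ye_xe_y^{-1}$ for all $x,y\in Q$. *)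

(* Defs.v *)
From HB Require Import structures.
From mathcomp Require Import all_boot.
From mathcomp Require Import boolp classical_sets.

Set Implicit Arguments.
Unset Strict Implicit.
Unset Printing Implicit Defensive.

Local Open Scope quotient_scope.
Local Open Scope classical_set_scope.
Local Open Scope group_scope.

Notation "{ 'ghom' G -> H }" := (UMagmaMorphism.type G H)
  (at level 0, G at level 98, H at level 99, format "{ 'ghom'  G  ->  H }").

Section Subgroups.
Variable G : groupType.
Implicit Types (A H : set G).

Definition subgroup H : Prop :=
  [/\ H 1, forall x y, H x -> H y -> H (x * y) & forall x, H x -> H x^-1].

Definition generated A : set G := smallest subgroup A.

Definition conj_stable H : Prop := forall x g, H x -> H (x ^ g).

Record normal_subgroup := NormalSubgroup {
  nsub :> set G;
  nsub_subgroup : subgroup nsub;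
  nsub_normal : conj_stable nsub }.

Definition normal_closure_set A : set G :=
  smallest [set H | subgroup H /\ conj_stable H] A.

Lemma normal_closure_subgroup A : subgroup (normal_closure_set A).
Proof.
split.
- by move=> H [[[]]].
- by move=> x y Hx Hy H HA; have [[[_ HM _] _] _] := HA; apply: HM; [exact: Hx|exact: Hy].
- by move=> x Hx H HA; have [[[_ _ HV] _] _] := HA; apply: HV; exact: Hx.
Qed.

Lemma normal_closure_normal A : conj_stable (normal_closure_set A).
Proof. by move=> x g Hx H HA; have [[_ HJ] _] := HA; apply: HJ; exact: Hx. Qed.

Definition normal_closure A : normal_subgroup :=
  NormalSubgroup (@normal_closure_subgroup A) (@normal_closure_normal A).

Definition commutator_set : set G :=
  generated [set c | exists x y, c = [~ x, y]].

Lemma commutator_subgroup : subgroup commutator_set.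
Proof.
split.
- by move=> H [[]].
- by move=> x y Hx Hy H HA; have [[_ HM _] _] := HA; apply: HM; [exact: Hx|exact: Hy].
- by move=> x Hx H HA; have [[_ _ HV] _] := HA; apply: HV; exact: Hx.
Qed.

Lemma commutator_normal : conj_stable commutator_set.
Proof.
move=> x g Hx H [[H1 HM HV] Hc].
apply: (Hx [set y | H (y ^ g)]); split=> /=; first split=> /=.
- by rewrite conj1g.
- by move=> y z Hy Hz; rewrite conjMg; apply: HM.
- by move=> y Hy; rewrite conjVg; apply: HV.
- by move=> _ [y [z ->]]; apply: Hc; exists (y ^ g), (z ^ g); rewrite conjRg.
Qed.

Definition commutator : normal_subgroup :=
  NormalSubgroup commutator_subgroup commutator_normal.

End Subgroups.

Section QuotientGroup.
Variables (G : groupType) (N : normal_subgroup G).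

Definition coset_rel : rel G := fun x y => `[< nsub N (x^-1 * y) >].

Lemma coset_rel_equiv : equiv_class_of coset_rel.
Proof.
have [N1 NM NV] := nsub_subgroup N.
split.
- by move=> x; apply/asboolP; rewrite mulVg.
- by move=> x y; apply/idP/idP => /asboolP/NV h; apply/asboolP;
    rewrite invgM invgK in h.
- move=> y x z /asboolP xy /asboolP yz; apply/asboolP.
  by have := NM _ _ xy yz; rewrite -mulgA mulVKg.
Qed.

Canonical coset_equiv := EquivRelPack coset_rel_equiv.

Definition quotient_group := {eq_quot coset_equiv}.
HB.instance Definition _ := Choice.on quotient_group.
HB.instance Definition _ := EqQuotient.on quotient_group.

Definition coset_class (x : G) : quotient_group := \pi x.

Lemma coset_eqP (x y : G) :
  coset_class x = coset_class y <-> nsub N (x^-1 * y).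
Proof.
split=> [/eqmodP|h]; first by move=> /asboolP.
by apply/eqmodP; apply/asboolP.
Qed.

Lemma coset_reprK (u : quotient_group) : coset_class (repr u) = u.
Proof. exact: reprK. Qed.

Definition quot_one : quotient_group := coset_class 1.
Definition quot_mul (u v : quotient_group) := coset_class (repr u * repr v).
Definition quot_inv (u : quotient_group) := coset_class (repr u)^-1.

Lemma coset_classM x y :
  quot_mul (coset_class x) (coset_class y) = coset_class (x * y).
Proof.
have [N1 NM NV] := nsub_subgroup N.
apply/coset_eqP; set a := repr _; set b := repr _.
have /coset_eqP ha : coset_class a = coset_class x by exact: coset_reprK.
have /coset_eqP hb : coset_class b = coset_class y by exact: coset_reprK.
have := NM _ _ (nsub_normal b ha) hb; congr (nsub _ _).
by rewrite conjgE invgM !mulgA mulgK.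
Qed.

Lemma coset_classV x : quot_inv (coset_class x) = coset_class x^-1.
Proof.
have [N1 NM NV] := nsub_subgroup N.
apply/coset_eqP; set a := repr _.
have /esym/coset_eqP ha : coset_class a = coset_class x by exact: coset_reprK.
have := nsub_normal x^-1 ha; congr (nsub _ _).
by rewrite conjgE !invgK !mulgA mulgV mul1g.
Qed.

Lemma quot_mulA : associative quot_mul.
Proof.
move=> u v w; rewrite -[u]coset_reprK -[v]coset_reprK -[w]coset_reprK.
by rewrite !coset_classM mulgA.
Qed.

Lemma quot_mul1 : left_id quot_one quot_mul.
Proof. by move=> u; rewrite -[u]coset_reprK coset_classM mul1g. Qed.

Lemma quot_mulr1 : right_id quot_one quot_mul.
Proof. by move=> u; rewrite -[u]coset_reprK coset_classM mulg1. Qed.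

Lemma quot_mulV : left_inverse quot_one quot_inv quot_mul.
Proof.
by move=> u; rewrite -[u]coset_reprK coset_classV coset_classM mulVg.
Qed.

Lemma quot_mulrV : right_inverse quot_one quot_inv quot_mul.
Proof.
by move=> u; rewrite -[u]coset_reprK coset_classV coset_classM mulgV.
Qed.

HB.instance Definition _ := isGroup.Build quotient_group
  quot_mulA quot_mul1 quot_mulr1 quot_mulV quot_mulrV.

Lemma coset_class_is_hom : {morph coset_class : x y / x / y}.
Proof.
by move=> x y; rewrite -coset_classM -coset_classV.
Qed.

HB.instance Definition _ :=
  isGroupMorphism.Build G quotient_group coset_class coset_class_is_hom.

End QuotientGroup.

Section Kernel.
Variables (G H : groupType) (p : {ghom G -> H}).

Definition kernel : set G := [set x | p x = 1].

Lemma kernel_subgroup : subgroup kernel.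
Proof.
split; rewrite /kernel /=; first exact: gmulf1.
- by move=> x y hx hy; rewrite gmulfM hx hy mulg1.
- by move=> x hx; rewrite gmulfV hx invg1.
Qed.

Lemma kernel_conj_stable : conj_stable kernel.
Proof. by move=> x g hx; rewrite /kernel /= gmulfJ hx conj1g. Qed.

Lemma kernel_group_closed : group_closed (mem kernel).
Proof.
split; first by apply/mem_set; rewrite /kernel /= gmulf1.
move=> x y /set_mem hx /set_mem hy; apply/mem_set.
by rewrite /kernel /= gmulfF hx hy divgg.
Qed.

Definition kernel_group : Type := set_type kernel.
HB.instance Definition _ := [isSub of kernel_group for @sval _ _].
HB.instance Definition _ := [Choice of kernel_group by <:].
HB.instance Definition _ :=
  SubChoice_isSubGroup.Build G (mem kernel) kernel_group kernel_group_closed.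

Definition kernel_incl : {ghom kernel_group -> G} :=
  (val : kernel_group -> G).

End Kernel.

Section QuotientLift.
Variables (G H : groupType) (N : normal_subgroup G) (p : {ghom G -> H}).
Hypothesis pN : N `<=` kernel p.

Definition quot_lift_fun (u : quotient_group N) : H := p (repr u).

Lemma quot_lift_class x : quot_lift_fun (coset_class N x) = p x.
Proof.
have /coset_eqP/pN : coset_class N (repr (coset_class N x)) = coset_class N x.
  exact: coset_reprK.
by rewrite /kernel /= gmulfM gmulfV => /mulg1_eq; rewrite invgK.
Qed.

Lemma quot_lift_is_hom : {morph quot_lift_fun : u v / u / v}.
Proof.
move=> u v; rewrite -[u]coset_reprK -[v]coset_reprK -gmulfF.
by rewrite !quot_lift_class gmulfF.
Qed.

HB.instance Definition _ := isGroupMorphism.Build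
  (quotient_group N) H quot_lift_fun quot_lift_is_hom.

Definition quot_lift : {ghom quotient_group N -> H} := quot_lift_fun.

End QuotientLift.

Section FreeGroup.
Variable X : choiceType.

(* The letter (x, true) stands for x and (x, false) for its inverse. *)
Definition word : choiceType := seq (X * bool).
Implicit Types u v w : word.

Inductive free_eq : word -> word -> Prop :=
| free_eq_refl w : free_eq w w
| free_eq_sym u v : free_eq u v -> free_eq v u
| free_eq_trans v u w : free_eq u v -> free_eq v w -> free_eq u w
| free_eq_cat u u' v v' :
    free_eq u u' -> free_eq v v' -> free_eq (u ++ v) (u' ++ v')
| free_eq_cancel x b : free_eq [:: (x, b); (x, ~~ b)] [::].

Definition free_rel : rel word := fun u v => `[< free_eq u v >].

Lemma free_rel_equiv : equiv_class_of free_rel.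
Proof.
split.
- by move=> u; apply/asboolP; apply: free_eq_refl.
- by move=> u v; apply/idP/idP => /asboolP h; apply/asboolP;
    apply: free_eq_sym.
- move=> v u w /asboolP uv /asboolP vw; apply/asboolP.
  exact: free_eq_trans uv vw.
Qed.

Canonical free_equiv := EquivRelPack free_rel_equiv.

Definition free_group := {eq_quot free_equiv}.
HB.instance Definition _ := Choice.on free_group.
HB.instance Definition _ := EqQuotient.on free_group.

Definition free_class (w : word) : free_group := \pi w.

Lemma free_classP u v : free_class u = free_class v <-> free_eq u v.
Proof.
split=> [/eqmodP|h]; first by move=> /asboolP.
by apply/eqmodP; apply/asboolP.
Qed.

Lemma free_reprK (u : free_group) : free_class (repr u) = u.
Proof. exact: reprK. Qed.

Definition winv (w : word) : word := rev [seq (a.1, ~~ a.2) | a <- w].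

Lemma winv_cat u v : winv (u ++ v) = winv v ++ winv u.
Proof. by rewrite /winv map_cat rev_cat. Qed.

Lemma winvK : involutive winv.
Proof.
move=> w; rewrite /winv map_rev revK -map_comp -[RHS]map_id.
by apply: eq_map => -[x b] /=; rewrite negbK.
Qed.

Lemma free_eq_winv u v : free_eq u v -> free_eq (winv u) (winv v).
Proof.
elim=> {u v} [w|u v _ h|v u w _ h1 _ h2|u u' v v' _ h1 _ h2|x b].
- exact: free_eq_refl.
- exact: free_eq_sym.
- exact: free_eq_trans h1 h2.
- by rewrite !winv_cat; apply: free_eq_cat.
- by rewrite /winv /= /rev /= negbK; apply: free_eq_cancel.
Qed.

Lemma free_eq_mulwV w : free_eq (w ++ winv w) [::].
Proof.
elim: w => [|[x b] w IHw]; first exact: free_eq_refl.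
rewrite -[(x, b) :: w]cat1s winv_cat -catA (catA w).
apply: (free_eq_trans (v := [:: (x, b)] ++ [::] ++ winv [:: (x, b)])).
  apply: free_eq_cat; first exact: free_eq_refl.
  by apply: free_eq_cat => //; apply: free_eq_refl.
exact: free_eq_cancel.
Qed.

Definition free_one : free_group := free_class [::].
Definition free_mul (u v : free_group) := free_class (repr u ++ repr v).
Definition free_inv (u : free_group) := free_class (winv (repr u)).

Lemma free_classM u v :
  free_mul (free_class u) (free_class v) = free_class (u ++ v).
Proof. by apply/free_classP; apply: free_eq_cat; apply/free_classP; apply: free_reprK. Qed.

Lemma free_classV u : free_inv (free_class u) = free_class (winv u).
Proof. by apply/free_classP; apply: free_eq_winv; apply/free_classP; apply: free_reprK. Qed.

Lemma free_mulA : associative free_mul.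
Proof.
move=> u v w; rewrite -[u]free_reprK -[v]free_reprK -[w]free_reprK.
by rewrite !free_classM catA.
Qed.

Lemma free_mul1 : left_id free_one free_mul.
Proof. by move=> u; rewrite -[u]free_reprK free_classM. Qed.

Lemma free_mulr1 : right_id free_one free_mul.
Proof. by move=> u; rewrite -[u]free_reprK free_classM cats0. Qed.

Lemma free_mulrV : right_inverse free_one free_inv free_mul.
Proof.
move=> u; rewrite -[u]free_reprK free_classV free_classM.
by apply/free_classP; apply: free_eq_mulwV.
Qed.

Lemma free_mulV : left_inverse free_one free_inv free_mul.
Proof.
move=> u; rewrite -[u]free_reprK free_classV free_classM.
by apply/free_classP; rewrite -{2}[repr u]winvK; apply: free_eq_mulwV.
Qed.

HB.instance Definition _ := isGroup.Build free_group
  free_mulA free_mul1 free_mulr1 free_mulV free_mulrV.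

Definition free_gen (x : X) : free_group := free_class [:: (x, true)].

Section Lift.
Variables (G : groupType) (f : X -> G).

Definition letter_eval (a : X * bool) : G := if a.2 then f a.1 else (f a.1)^-1.
Definition word_eval (w : word) : G := \prod_(a <- w) letter_eval a.

Lemma word_eval_cat u v : word_eval (u ++ v) = word_eval u * word_eval v.
Proof. by rewrite /word_eval big_cat. Qed.

Lemma word_eval_free_eq u v : free_eq u v -> word_eval u = word_eval v.
Proof.
elim=> {u v} [w|u v _ ->|v u w _ -> _ ->|u u' v v' _ h1 _ h2|x b] //.
- by rewrite !word_eval_cat h1 h2.
- rewrite /word_eval !big_cons !big_nil /letter_eval /= mulg1.
  by case: b => /=; rewrite ?mulgV ?mulVg.
Qed.

Definition free_lift_fun (u : free_group) : G := word_eval (repr u).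

Lemma free_lift_class w : free_lift_fun (free_class w) = word_eval w.
Proof. by apply: word_eval_free_eq; apply/free_classP; apply: free_reprK. Qed.

Lemma free_lift_funM : {morph free_lift_fun : u v / u * v}.
Proof.
move=> u v; rewrite -[u]free_reprK -[v]free_reprK.
rewrite [_ * _]free_classM !free_lift_class.
exact: word_eval_cat.
Qed.

Lemma free_lift_fun1 : free_lift_fun 1 = 1.
Proof. by rewrite -[1]/free_one free_lift_class /word_eval big_nil. Qed.

HB.instance Definition _ := isUMagmaMorphism.Build
  free_group G free_lift_fun (conj free_lift_fun1 free_lift_funM).

Definition free_lift : {ghom free_group -> G} := free_lift_fun.

Lemma free_lift_gen x : free_lift (free_gen x) = f x.
Proof.
by rewrite [LHS]free_lift_class /word_eval big_cons big_nil mulg1.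
Qed.

End Lift.
End FreeGroup.

Definition presented_group (X : choiceType) (R : set (free_group X)) :
  groupType := quotient_group (normal_closure R).

Section Extensions.
Variables (K E G : groupType) (i : {ghom K -> E}) (p : {ghom E -> G}).

(* 1 -> K -> E -> G -> 1 *)
Definition short_exact : Prop :=
  [/\ injective i, range i = kernel p & forall g, exists e, p e = g].

Definition central_extension : Prop :=
  short_exact /\ forall k e, commute (i k) e.

Definition splits : Prop := exists s : {ghom G -> E}, cancel s p.

End Extensions.

Definition abelianization (G : groupType) : groupType :=
  quotient_group (commutator G).

Definition has_torsion (G : groupType) : Prop :=
  exists2 x : G, x <> 1 & exists2 n, (0 < n)%N & x ^+ n = 1.

HB.mixin Record isQuandle Q of Choice Q := {
  qop : Q -> Q -> Q;
  quandle_inhabited : inhabited Q;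
  qop_idem : forall x, qop x x = x;
  qop_div : forall x y, exists! z, x = qop z y;
  qop_dist : forall x y z, qop (qop x y) z = qop (qop x z) (qop y z) }.

#[short(type="quandleType")]
HB.structure Definition Quandle := {Q of isQuandle Q & Choice Q}.

Section Env.
Variable Q : quandleType.

Definition env_relators : set (free_group Q) :=
  [set r | exists x y : Q, r = free_gen (qop x y) *
    (free_gen y * free_gen x * (free_gen y)^-1)^-1].

Definition Env : groupType := presented_group env_relators.

Definition env_gen (x : Q) : Env :=
  coset_class (normal_closure env_relators) (free_gen x).

Lemma env_genE x y :
  env_gen (qop x y) = env_gen y * env_gen x * (env_gen y)^-1.
Proof.
set c := coset_class (normal_closure env_relators).
have <- : c (free_gen y * free_gen x * (free_gen y)^-1) =
    env_gen y * env_gen x * (env_gen y)^-1 by rewrite /c gmulfF gmulfM.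
apply/esym/coset_eqP.
set u := _ * _ * _; set v := free_gen (qop x y).
have : normal_closure_set env_relators (v * u^-1).
  by apply: sub_gen_smallest; exists x, y.
by move/(@normal_closure_normal _ env_relators _ u); rewrite conjgE mulgVK.
Qed.

Section Lift.
Variables (G : groupType) (f : Q -> G).
Hypothesis fE : forall x y, f (qop x y) = f y * f x * (f y)^-1.

Lemma env_relators_lift : normal_closure env_relators `<=` kernel (free_lift f).
Proof.
move=> w; apply; split; first split.
- exact: kernel_subgroup.
- exact: kernel_conj_stable.
- move=> _ [x [y ->]]; apply: etrans (gmulfF _ _ _) _; rewrite gmulfF gmulfM.
  by rewrite !free_lift_gen fE mulgV.
Qed.

Definition env_lift : {ghom Env -> G} := quot_lift env_relators_lift.

Lemma env_lift_gen x : env_lift (env_gen x) = f x.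
Proof. by rewrite [LHS]quot_lift_class ?free_lift_gen//; apply: env_relators_lift. Qed.

End Lift.
End Env.

Section DehnQuandle.
Variables (G : groupType) (A : set G).

Definition conjugates : set G := [set x | exists g a, A a /\ x = g * a * g^-1].

Lemma conjugatesJ x y : conjugates x -> conjugates (y * x * y^-1).
Proof.
by move=> [g [a [Aa ->]]]; exists (y * g), a; rewrite invgM !mulgA.
Qed.

Definition dehn_quandle of A !=set0 : Type := set_type conjugates.

Hypothesis A0 : A !=set0.
Local Notation D := (dehn_quandle A0).

HB.instance Definition _ := [isSub of D for @sval _ _].
HB.instance Definition _ := [Choice of D by <:].

Lemma dehn_op_subproof (x y : D) :
  val y * val x * (val y)^-1 \in conjugates.
Proof. by apply/mem_set/conjugatesJ/set_mem/(valP x). Qed.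

Definition dehn_op (x y : D) : D :=
  Sub (val y * val x * (val y)^-1) (dehn_op_subproof x y).

Lemma val_dehn_op x y : val (dehn_op x y) = val y * val x * (val y)^-1.
Proof. exact: SubK. Qed.

Lemma dehn_inhabited : inhabited D.
Proof.
have [a Aa] := A0; suff ca : a \in conjugates by exact: (inhabits (Sub a ca : D)).
by apply/mem_set; exists 1, a; rewrite mul1g invg1 mulg1.
Qed.

Lemma dehn_opxx x : dehn_op x x = x.
Proof. by apply: val_inj; rewrite val_dehn_op mulgK. Qed.

Lemma dehn_op_div x y : exists! z, x = dehn_op z y.
Proof.
have cz : (val y)^-1 * val x * val y \in conjugates.
  apply/mem_set; rewrite -[X in _ * X]invgK; apply: conjugatesJ.
  exact: set_mem (valP x).
exists (Sub ((val y)^-1 * val x * val y) cz : D); split.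
  by apply: val_inj; rewrite val_dehn_op SubK !mulgA mulgV mul1g mulgK.
move=> z xE; apply: val_inj; rewrite SubK xE val_dehn_op.
by rewrite !mulgA mulVg mul1g mulgVK.
Qed.

Lemma dehn_op_dist x y z :
  dehn_op (dehn_op x y) z = dehn_op (dehn_op x z) (dehn_op y z).
Proof. by apply: val_inj; rewrite !val_dehn_op !invgM !invgK !mulgA !mulgVK. Qed.

HB.instance Definition _ := isQuandle.Build D
  dehn_inhabited dehn_opxx dehn_op_div dehn_op_dist.

Definition dehn_env_hom : {ghom Env D -> G} := env_lift val_dehn_op.

Lemma dehn_env_homE (x : D) : dehn_env_hom (env_gen x) = val x.
Proof. exact: env_lift_gen. Qed.

End DehnQuandle.

(* Main.v *)
Require Import Defs.
From HB Require Import structures.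
From mathcomp Require Import all_boot all_algebra.
From mathcomp Require Import boolp classical_sets.

(** Two observations about [Env Q] carry the proof.

    Centrality.  Conjugation in [Env Q] permutes the generators: by the
    defining relations and the bijectivity of right translations, every
    [u * e_x * u^-1] is again some [e_y] ([env_gen_conj_closed]).  For a Dehn
    quandle, [Phi] tells the generators apart, as [Phi e_y = y], so [y] can be
    read off as [Phi u * x * (Phi u)^-1].  When [Phi u = 1] this gives [y = x],
    hence [u] commutes with all generators ([kernel_dehn_env_central]).

    No splitting.  The abelianization of [Env Q] is free abelian on the orbits
    of [Q], and a section of [Phi] would embed [G_ab] in it, which torsion
    forbids.  The argument is run without constructing that free abelian group:
    its coordinates are replaced by homomorphisms [Env Q -> Z].  For each [t] in
    [G_ab], let [deg_t] count with signs the generators [e_x] such that the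
    class of [x] in [G_ab] is [t]; this is well defined since conjugate elements
    have the same class.  Collecting equal terms shows that the class of [Phi u]
    is the combination of the [t]'s with coefficients [deg_t u], so it is
    trivial as soon as all [deg_t u] vanish ([env_sum_degree0]).  Given a
    section [s] and a [g] in [G] with torsion class, each [deg_t \o s] is a
    homomorphism from [G] to the torsion-free group [Z], so it vanishes at [g]
    ([torsion_int_hom]); then the class of [g = Phi (s g)] is trivial. *)

Set Implicit Arguments.
Unset Strict Implicit.
Unset Printing Implicit Defensive.

Import GRing.Theory Num.Theory Algebra.

Local Open Scope group_scope.

Lemma word_eval_hom (X : choiceType) (G H : groupType) (p : {ghom G -> H})
    (f : X -> G) (w : word X) :
  p (word_eval f w) = word_eval (p \o f) w.
Proof.
rewrite /word_eval gmulf_prod; apply: eq_bigr => -[x []] _ //.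
by rewrite /letter_eval/= gmulfV.
Qed.

Lemma free_class_word_eval (X : choiceType) (w : word X) :
  free_class w = word_eval (@free_gen X) w.
Proof.
elim: w => [|[x b] w IHw]; first by rewrite /word_eval big_nil.
rewrite /word_eval big_cons -[\prod_(j <- w) _]/(word_eval _ w) -IHw.
rewrite -[(x, b) :: w]cat1s -free_classM; congr (_ * _).
by case: b; rewrite // /letter_eval/= [RHS]free_classV.
Qed.

Definition letter_sign (b : bool) : int := if b then 1%R else (-1)%R.

Lemma word_eval_sum (X : choiceType) (W : zmodType) (g : X -> W) (w : word X) :
  word_eval (g : X -> to_multiplicative W) w =
  (\sum_(a <- w) g a.1 *~ letter_sign a.2)%R.
Proof.
by apply: eq_bigr => -[x []] _ //=; rewrite /letter_eval/= ?mulr1z// mulrNz mulr1z.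
Qed.

Section EnvelopingGroup.
Variable Q : quandleType.
Implicit Types (x y : Q) (u : Env Q).

Lemma env_word u : exists w : word Q, u = word_eval (@env_gen Q) w.
Proof.
exists (repr (repr u)); rewrite -[LHS]coset_reprK -[X in coset_class _ X]free_reprK.
by rewrite free_class_word_eval word_eval_hom.
Qed.

(** Left multiplication of [u] by [e_z] replaces [y] by [qop y z], and by its
    inverse replaces [y] by the solution [y'] of [y = qop y' z]; so the claim
    follows by induction on a word for [u]. *)
Lemma env_gen_conj_closed u x : exists y, u * env_gen x * u^-1 = env_gen y.
Proof.
have [w ->] := env_word u; elim: w => [|[z b] w [y IHw]].
  by exists x; rewrite /word_eval big_nil mul1g invg1 mulg1.
rewrite /word_eval big_cons -[\prod_(j <- w) _]/(word_eval _ w).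
set v := word_eval _ w in IHw *.
suff [y' y'E] : exists y', letter_eval (@env_gen Q) (z, b) * env_gen y *
    (letter_eval (@env_gen Q) (z, b))^-1 = env_gen y'.
  by exists y'; rewrite -y'E -IHw invgM !mulgA.
rewrite /letter_eval/=; case: b; first by exists (qop y z); rewrite env_genE.
have [y' [-> _]] := qop_div y z.
by exists y'; rewrite env_genE invgK !mulgA mulVg mul1g mulgVK.
Qed.

Lemma env_lift_word (G : groupType) (f : Q -> G)
    (fE : forall x y, f (qop x y) = f y * f x * (f y)^-1) (w : word Q) :
  env_lift fE (word_eval (@env_gen Q) w) = word_eval f w.
Proof.
by rewrite word_eval_hom; congr word_eval; apply/funext => x /=; apply: env_lift_gen.
Qed.

Lemma commute_env_gen (v : Env Q) : (forall x, commute v (env_gen x)) ->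
  forall u, commute v u.
Proof.
move=> vx u; have [w ->] := env_word u.
by apply: commute_prod => -[x []] _; rewrite /letter_eval/=; [|apply: commuteV].
Qed.

(** In a commutative target the relations of [Env Q] only say that [g] is
    constant on orbits. *)
Lemma invariant_lift (W : zmodType) (g : Q -> to_multiplicative W) :
  (forall x y, g (qop x y) = g x) ->
  forall x y, g (qop x y) = g y * g x * (g y)^-1.
Proof. by move=> g_inv x y; rewrite g_inv (commuteT (g y)) mulgK. Qed.

Definition env_sum (W : zmodType) (g : Q -> W)
    (g_inv : forall x y, g (qop x y) = g x) :
  {ghom Env Q -> to_multiplicative W} := env_lift (invariant_lift g_inv).

End EnvelopingGroup.

Section Degree.
Variables (Q : quandleType) (V : zmodType) (f : Q -> V).
Hypothesis f_inv : forall x y, f (qop x y) = f x.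

Lemma fiber_inv t x y : ((f (qop x y) == t)%:Z = (f x == t)%:Z)%R.
Proof. by rewrite f_inv. Qed.

(** The fibers of [f] are unions of orbits.  Grading by them rather than by
    single orbits is enough, as only the values of [f] are to be summed, and
    lets the degrees be indexed by [V]. *)
Definition fiber_degree t : {ghom Env Q -> to_multiplicative int} :=
  env_sum (fiber_inv t).

(** Collecting the letters of a word for [u] by their value under [f], the
    coefficient of [t] in the total sum is [fiber_degree t u]. *)
Lemma env_sum_degree0 u :
  (forall t, fiber_degree t u = 1) -> env_sum f_inv u = 1.
Proof.
have [w ->] := env_word u.
rewrite /fiber_degree /env_sum env_lift_word word_eval_sum => deg0.
(* The values taken on a word are finitely many, which makes the sum over
   [t : V] a finite one. *)
pose r := undup [seq f a.1 | a <- w].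
transitivity (\sum_(t <- r) t *~ (\sum_(a <- w)
    (f a.1 == t)%:Z *~ letter_sign a.2))%R; last first.
  rewrite big1// => t _.
  by have := deg0 t; rewrite env_lift_word word_eval_sum => ->.
under [RHS]eq_bigr do rewrite mulrz_sumr.
rewrite exchange_big/=; apply: eq_big_seq => -[x b] xw /=.
rewrite (bigD1_seq (f x)) ?undup_uniq ?mem_undup//=; last first.
  exact: (map_f (fun a => f a.1) xw).
rewrite eqxx intz big1 ?addr0//.
by move=> t /negPf; rewrite eq_sym => ->; rewrite mul0rz mulr0z.
Qed.

End Degree.

Section Abelianization.
Variable G : groupType.

Lemma abelianization_mulC : commutative ( *%g : abelianization G -> _ -> _).
Proof.
move=> u v; rewrite -[u]coset_reprK -[v]coset_reprK -!gmulfM.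
apply/coset_eqP; apply: sub_gen_smallest; exists (repr v), (repr u).
by rewrite commgEl invgM conjgE !mulgA.
Qed.

(** A copy of the abelianization in additive notation, so that finite sums can
    be rearranged and scaled by integers. *)
Definition additive_abelianization : Type := abelianization G.
HB.instance Definition _ := Choice.on additive_abelianization.
HB.instance Definition _ := GRing.isZmodule.Build additive_abelianization
  (@mulgA (abelianization G)) abelianization_mulC
  (@mul1g (abelianization G)) (@mulVg (abelianization G)).

Lemma commutator_zmod_hom (W : zmodType)
    (p : {ghom G -> to_multiplicative W}) (x : G) :
  commutator_set x -> p x = 1.
Proof.
move=> /(_ (kernel p)); apply; split; first exact: kernel_subgroup.
move=> _ [y [z ->]]; rewrite /kernel/= gmulfR; apply/eqP/commgP.
exact: commuteT.
Qed.

(** [p] factors through the abelianization, and [Z] is torsion-free. *)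
Lemma torsion_int_hom (p : {ghom G -> to_multiplicative int}) (x : G) n :
  (0 < n)%N -> coset_class (commutator G) x ^+ n = 1 -> p x = 1.
Proof.
move=> n0; rewrite -gmulfXn => /esym/coset_eqP; rewrite invg1 mul1g.
move=> /(commutator_zmod_hom p); rewrite gmulfXn => pxn.
have : ((p x : int) *+ n == 0)%R by apply/eqP.
by rewrite mulrn_eq0 eqn0Ngt n0 => /eqP.
Qed.

End Abelianization.

Section DehnEnvelope.
Variables (G : groupType) (S : set G) (S0 : (S !=set0)%classic).
Local Notation D := (dehn_quandle S0).
Local Notation Phi := (dehn_env_hom S0).

Lemma dehn_env_surjective : generated S = setT -> forall g, exists e, Phi e = g.
Proof.
move=> genS g; have : generated S g by rewrite genS.
move=> /(_ [set h | exists e, Phi e = h]%classic).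
apply; split; first split.
- by exists 1; rewrite gmulf1.
- by move=> _ _ [e <-] [e' <-]; exists (e * e'); rewrite gmulfM.
- by move=> _ [e <-]; exists e^-1; rewrite gmulfV.
- move=> s Ss; have cs : s \in conjugates S.
    by apply/mem_set; exists 1, s; rewrite mul1g invg1 mulg1.
  by exists (env_gen (Sub s cs : D)); rewrite dehn_env_homE SubK.
Qed.

(** [Phi] is injective on generators, so a conjugate of [e_x] by an element of
    the kernel, being a generator with the same image, is [e_x] itself. *)
Lemma kernel_dehn_env_central (z : Env D) : Phi z = 1 ->
  forall u, commute z u.
Proof.
move=> z1; apply: commute_env_gen => x.
have [y zx] := env_gen_conj_closed z x.
have /val_inj xy : val x = val y.
  by rewrite -!dehn_env_homE -zx !gmulfM z1 mul1g gmulfV z1 invg1 mulg1.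
by rewrite /commute {2}xy -zx mulgVK.
Qed.

Definition dehn_class (x : D) : additive_abelianization G :=
  coset_class (commutator G) (val x).

Lemma dehn_class_inv (x y : D) : dehn_class (qop x y) = dehn_class x.
Proof.
rewrite /dehn_class val_dehn_op !gmulfM gmulfV.
by rewrite [X in X * _]abelianization_mulC mulgK.
Qed.

Lemma dehn_env_sumE (u : Env D) :
  env_sum dehn_class_inv u = coset_class (commutator G) (Phi u).
Proof.
have [w ->] := env_word u.
by rewrite !env_lift_word word_eval_hom.
Qed.

Lemma dehn_env_no_section : has_torsion (abelianization G) -> ~ splits Phi.
Proof.
move=> [x x1 [n n0 xn]] [s sK]; apply: x1.
rewrite -[x]coset_reprK -[repr x]sK -dehn_env_sumE.
apply: (@env_sum_degree0 _ _ _ (@dehn_class_inv)) => t.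
apply: (torsion_int_hom (fiber_degree dehn_class_inv t \o s) n0).
by rewrite coset_reprK.
Qed.

End DehnEnvelope.

Theorem theorem3p7 (G : groupType) (S : set G) (S0 : (S !=set0)%classic)
    (genS : generated S = setT) :
  let Phi : {ghom Env (dehn_quandle S0) -> G} := dehn_env_hom S0 in
  central_extension (kernel_incl Phi) Phi /\
  (has_torsion (abelianization G) -> ~ splits Phi).
Proof.
move=> Phi; split; last exact: dehn_env_no_section.
split; last by move=> k e; apply: kernel_dehn_env_central; apply: set_mem (valP k).
split; first exact: val_inj; last exact: dehn_env_surjective.
apply/seteqP; split => [_ [k _ <-]|e ke]; first exact: set_mem (valP k).
by exists (Sub e (mem_set ke) : kernel_group Phi); rewrite ?SubK.
Qed.
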